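(* Let $X$ be a real Banach space, $T>0$, and let $\varphi:X\to X$ be a homeomorphism with $\varphi(0)=0$ whose inverse $\varphi^{-1}$ is Lipschitz with constant $k$. Suppose that $f:[0,T]\times X\times X\to X$ is completely continuous and that there exist two numbers $c_0,c_1\ge 0$ such that $$\|f(t,x,y)\|\le c_0+c_1\|y\|\qquad\text{for all }(t,x,y)\in[0,T]\times X\times X.$$ Then the boundary value problem $$(\varphi(u'))'=f(t,u,u'),\qquad u(T)=0=u'(0)$$ has at least one solution.
   Context: A map is completely continuous if it is continuous and sends bounded sets to relatively compact sets. That $\varphi^{-1}$ is Lipschitz with constant $k$ means $k>0$ and $\|\varphi^{-1}(x)-\varphi^{-1}(y)\|\le k\|x-y\|$ for all $x,y\in X$. A solution of the boundary value problem is a function $u:[0,T]\to X$ of class $C^1$ such that $t\mapsto\varphi(u'(t))$ is continuously differentiable, $u(T)=0=u'(0)$, and $(\varphi(u'(t)))'=f(t,u(t),u'(t))$ for all $t\in[0,T]$. *)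

(* Defs.v *)
From mathcomp Require Import all_boot all_order all_algebra.
From mathcomp Require Import all_classical all_reals all_analysis.

Set Implicit Arguments.
Unset Strict Implicit.
Unset Printing Implicit Defensive.

Import Order.TTheory GRing.Theory Num.Theory.
Import numFieldNormedType.Exports.

Local Open Scope classical_set_scope.
Local Open Scope ring_scope.

Definition homeomorphism_with_inverse (U V : topologicalType)
    (g : U -> V) (ginv : V -> U) : Prop :=
  [/\ cancel g ginv, cancel ginv g, continuous g & continuous ginv].

(* [g] is a map defined on [D]: its values off [D] play no role. *)
Definition completely_continuous_on (K : numFieldType)
    (U V : pseudoMetricNormedZmodType K) (D : set U) (g : U -> V) : Prop :=
  {within D, continuous g} /\
  forall B : set U, B `<=` D -> bounded_set B -> precompact (g @` B).

(* Derivatives relative to a set [A] of reals: the increments stay in [A], so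
   they are one-sided at the endpoints of a closed interval. [derive_in A u t]
   is meaningful only when [derivable_in A u t] holds. *)
Section derivative_in.
Context {R : realType} {X : normedModType R}.
Implicit Types (A : set R) (u : R -> X) (t : R).

Definition derivable_in A u t : Prop :=
  cvg ((s - t)^-1 *: (u s - u t) @[s --> within A t^']).

Definition derive_in A u t : X :=
  lim ((s - t)^-1 *: (u s - u t) @[s --> within A t^']).

Definition C1_on A u : Prop :=
  {in A, forall t, derivable_in A u t} /\
  {within A, continuous (derive_in A u)}.

End derivative_in.

(* A function on [0, T] is represented by a function on R of which only the
   restriction to [0, T] matters. *)
Definition bvp_solution (R : realType) (X : normedModType R) (T : R)
    (phi : X -> X) (f : R * X * X -> X) (u : R -> X) : Prop :=
  let I := `[0, T]%classic in
  let u' := derive_in I u in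
  [/\ C1_on I u,
      C1_on I (phi \o u'),
      u T = 0 /\ u' 0 = 0 &
      forall t, t \in I -> derive_in I (phi \o u') t = f (t, u t, u' t)].

(* Main.v *)
Require Import Defs.
From mathcomp Require Import all_boot all_order all_algebra.
From mathcomp Require Import all_classical all_reals all_analysis.
From mathcomp Require Import ring lra.

Set Implicit Arguments.
Unset Strict Implicit.
Unset Printing Implicit Defensive.

Import Order.TTheory GRing.Theory Num.Theory.
Import numFieldNormedType.Exports.

Local Open Scope classical_set_scope.
Local Open Scope ring_scope.

(** With w = phi(u') the problem is a first-order system for the pair (u, w),
namely u' = phiinv(w), w' = f(t, u, phiinv(w)), with w(0) = 0 and u(T) = 0. Only
the initial value a = u(0) is unknown, and it has to be chosen so that u(T) = 0.
Solutions issued from a need not be unique, so the shooting is done on the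
explicit Euler scheme, whose end value is a continuous function of a.

As phiinv vanishes at 0 and is k-Lipschitz, |u'| <= k |w|, and the growth bound
on f gives, by a discrete Gronwall inequality, bounds on w and u' independent of
a and of the mesh ([euler_w_bound]). Hence the map sending a to a - u(T) maps
some ball into itself. It is continuous, and its range is totally bounded: w is
a Riemann sum of elements of the relatively compact image of a bounded set under
f, u - a is a Riemann sum of elements of the image under phiinv of the set of
such sums, and Riemann sums of elements of a totally bounded set form a totally
bounded set ([totally_bounded_riemann_sums]). An approximate form of Schauder's
theorem ([schauder_approx]) yields, for every number of steps, a polygon with
u(T) as small as desired.

All these polygons take their values in fixed totally bounded sets of a complete
space, so they converge pointwise on [0, T] along an ultrafilter. Their slopes
are bounded, and with this, pointwise convergence is enough to see that the
limit is differentiable and solves the system ([euler_limit]).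

Schauder's theorem rests on Brouwer's theorem for cubes ([brouwer_cube]), which
follows by compactness from a combinatorial statement
([discrete_poincare_miranda]): if 0/1 labels s_1, ..., s_m on a grid are such
that s_i is 0 where the i-th coordinate is minimal and 1 where it is maximal,
then some unit cube of the grid sees both values of every label. Indeed the cup
product of the coboundaries of the s_i, summed modulo 2 over the grid, reduces
by Stokes' formula to the same sum on a face, and is therefore 1. *)

(** * Parity of labelled grids *)

Lemma addFF2 (x : 'F_2) : x + x = 0.
Proof. by apply: addrr_pchar2; apply: pchar_Fp. Qed.

(** The pairs (d, e) and (e, d) cancel modulo 2; this is the cancellation of
interior facets in every parity argument below. *)
Lemma big_offdiag_sym (D : seq nat) (g : nat -> nat -> 'F_2) :
  (forall d e, g d e = g e d) ->
  \sum_(d <- D) \sum_(e <- D | e != d) g d e = 0.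
Proof.
move=> gC.
have split_lt d : \sum_(e <- D | e != d) g d e =
    \sum_(e <- D | (e < d)%N) g d e + \sum_(e <- D | (d < e)%N) g d e.
  rewrite (bigID (fun e => (e < d)%N)) /=; congr (_ + _);
    by apply: eq_bigl => e; case: ltngtP.
rewrite (eq_bigr _ (fun d _ => split_lt d)) big_split /=.
rewrite [X in _ + X](exchange_big_dep xpredT) //=.
rewrite [X in _ + X](_ : _ = \sum_(d <- D) \sum_(e <- D | (e < d)%N) g d e).
  exact: addFF2.
by apply: eq_bigr => d _; apply: eq_bigr => e _; exact: gC.
Qed.

Section grid_cochains.

Definition step (d : nat) (x : nat -> nat) : nat -> nat :=
  fun i => (x i + (i == d))%N.

Definition upd (x : nat -> nat) (d c : nat) : nat -> nat :=
  fun i => if i == d then c else x i.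

Definition without (d : nat) (D : seq nat) := [seq e <- D | e != d].

Lemma stepC d e x : step d (step e x) = step e (step d x).
Proof. by apply/funext => i; rewrite /step addnAC. Qed.

Lemma updC d e c c' x : d != e -> upd (upd x d c) e c' = upd (upd x e c') d c.
Proof.
move=> de; apply/funext => i; rewrite /upd.
by have [->|] := eqVneq i e; rewrite // eq_sym (negbTE de).
Qed.

Lemma withoutC d e D : without d (without e D) = without e (without d D).
Proof. by rewrite /without -!filter_predI; apply: eq_filter => i /=; rewrite andbC. Qed.

Lemma without_notin d D : d \notin D -> without d D = D.
Proof.
by move=> dD; apply/all_filterP/allP => e eD; apply: contraNneq dD => <-.
Qed.

Lemma size_without d D n :
  uniq D -> d \in D -> size D = n.+1 -> size (without d D) = n.
Proof.
by move=> uD dD sD; rewrite /without -(rem_filter _ uD) size_rem // sD.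
Qed.

(** For 0/1 labels [s l] of the lattice points, this is the cup product of the
coboundaries of the [s l], [l] in [L], evaluated on the cube with lowest corner
[x] and edge directions [D], cut into the simplices x < x + e_d1 < x + e_d1 +
e_d2 < ... of the Freudenthal triangulation: one simplex for each order in
which the directions are used up. Recursion on [L] replaces the sum over
permutations. When [D] has more directions than [L] has labels, the sum runs
over the initial parts of the orders. *)
Fixpoint cube_cup (s : nat -> (nat -> nat) -> 'F_2) (L : seq nat)
    (x : nat -> nat) (D : seq nat) : 'F_2 :=
  if L is l :: L' then
    \sum_(d <- D) (s l (step d x) + s l x) * cube_cup s L' (step d x) (without d D)
  else 1.

Variable s : nat -> (nat -> nat) -> 'F_2.

Lemma big_without (D : seq nat) d (F : nat -> 'F_2) :
  \sum_(e <- without d D) F e = \sum_(e <- D | e != d) F e.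
Proof. by rewrite /without big_filter. Qed.

(** Cocycle identity: a cup product of coboundaries has coboundary 0. On the
cube with one direction too many, all facets cancel except those that omit the
first vertex, on the left, and those that omit the last one, on the right. *)
Lemma cube_cup_first L x D : uniq D -> size D = (size L).+1 ->
  \sum_(d <- D) cube_cup s L (step d x) (without d D) = cube_cup s L x D.
Proof.
elim: L x D => [|l L IH] x D uD.
  by case: D uD => [|d [|e D]] //= _ _; rewrite big_seq1.
move=> sD.
have IHd d : d \in D -> forall y, \sum_(e <- without d D)
    cube_cup s L (step e y) (without e (without d D)) = cube_cup s L y (without d D).
  move=> dD y; apply: IH; rewrite ?filter_uniq //.
  exact: size_without sD.
have two_steps_vanish (w : (nat -> nat) -> 'F_2) :
    \sum_(d <- D) \sum_(e <- without d D)
      w (step e (step d x)) * cube_cup s L (step e (step d x)) (without e (without d D)) = 0.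
  under eq_bigr do rewrite big_without.
  by apply: big_offdiag_sym => d e; rewrite stepC withoutC.
have -> : \sum_(d <- D) cube_cup s (l :: L) (step d x) (without d D) =
    \sum_(d <- D) s l (step d x) * cube_cup s L (step d x) (without d D).
  rewrite /=.
  under eq_bigr do under eq_bigr do rewrite mulrDl.
  under eq_bigr do rewrite big_split /=.
  rewrite big_split /= two_steps_vanish add0r.
  apply: eq_big_seq => d dD.
  by rewrite -big_distrr /= IHd.
rewrite /=; under [RHS]eq_bigr do rewrite mulrDl.
rewrite big_split /= -[LHS]addr0; congr (_ + _).
rewrite -big_distrr /=.
have -> : \sum_(d <- D) cube_cup s L (step d x) (without d D) = 0; last by rewrite mulr0.
have := two_steps_vanish (fun=> 1).
under eq_bigr do under eq_bigr do rewrite mul1r.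
move=> e0; apply: etrans e0; apply: eq_big_seq => d dD.
by rewrite IHd.
Qed.

(** Dropping the last vertex of a simplex amounts to choosing a direction that
is never used, hence to a sum over the faces through the corner [x]. *)
Lemma cube_cup_last L x D : uniq D -> size D = (size L).+1 ->
  cube_cup s L x D = \sum_(d <- D) cube_cup s L x (without d D).
Proof.
elim: L x D => [|l L IH] x D uD sD.
  by case: D sD {uD} => [|d [|e D]] //= _; rewrite big_seq1.
rewrite /=.
under [RHS]eq_bigr do rewrite big_without.
rewrite [RHS](exchange_big_dep xpredT) //=.
apply: eq_big_seq => d dD.
rewrite IH ?filter_uniq //; last exact: size_without sD.
rewrite big_distrr /= big_without.
under eq_bigl do rewrite eq_sym.
by apply: eq_bigr => e _; rewrite withoutC.
Qed.

(** Discrete Stokes formula: the product of d(s l) with the cocycle is the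
coboundary of [s l] times the cocycle, so on a cube it is the sum of the latter
over the faces of the cube, two parallel ones for each direction. *)
Lemma cube_cup_stokes l L x D : uniq D -> size D = (size L).+1 ->
  cube_cup s (l :: L) x D =
  \sum_(d <- D) (s l (step d x) * cube_cup s L (step d x) (without d D)
                 + s l x * cube_cup s L x (without d D)).
Proof.
move=> uD sD; rewrite /=; under eq_bigr do rewrite mulrDl.
rewrite !big_split /=; congr (_ + _).
by rewrite -!big_distrr /= cube_cup_first // cube_cup_last.
Qed.

(** On a face where coordinate [l] is constant and extremal, the label [s l] is
constant and its coboundary vanishes. *)
Lemma cube_cup_face L x D l N :
  (forall y c, y l = c -> c = 0%N \/ c = N -> s l y = (c == N)%:R) ->
  l \in L -> l \notin D -> x l = 0%N \/ x l = N -> cube_cup s L x D = 0.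
Proof.
move=> sl; elim: L x D => //= a L IH x D.
rewrite inE => laL lD xl.
have step_l d : d \in D -> step d x l = x l.
  by move=> dD; rewrite /step (_ : l == d = false) ?addn0 //; apply: contraNF lD => /eqP ->.
rewrite big_seq big1 // => d dD.
have [la|la] := eqVneq l a.
  rewrite -la (sl _ (x l)) ?step_l // (sl x (x l)) //.
  by rewrite addFF2 mul0r.
rewrite IH ?mulr0 ?step_l //.
- by move: laL; rewrite (negbTE la).
- by rewrite mem_filter (negbTE lD) andbF.
Qed.

Section sums.
Variable N : nat.

Fixpoint grid_sum (D : seq nat) (F : (nat -> nat) -> 'F_2) (x : nat -> nat) : 'F_2 :=
  if D is d :: D' then \sum_(0 <= i < N) grid_sum D' F (upd x d i) else F x.

Lemma grid_sum_without (D : seq nat) F x d : d \in D -> uniq D ->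
  grid_sum D F x = grid_sum (d :: without d D) F x.
Proof.
elim: D x => //= a D IH x.
rewrite inE => daD /andP[aD uD].
have [ea|nea] := eqVneq a d; first by subst a; rewrite without_notin.
have dD : d \in D by move: daD; rewrite eq_sym (negbTE nea).
under eq_bigr do rewrite IH //=.
rewrite /= exchange_big /=; apply: eq_bigr => i _; apply: eq_bigr => j _.
by rewrite updC.
Qed.

Lemma grid_sum_step D F x d c : d \notin D ->
  grid_sum D (F \o step d) (upd x d c) = grid_sum D F (upd x d c.+1).
Proof.
elim: D x => [|a D IH] x /=.
  move=> _; congr F; apply/funext => i; rewrite /step /upd.
  by case: eqVneq => _; rewrite ?addn1 ?addn0.
rewrite inE negb_or => /andP[da dD]; apply: eq_bigr => i _.
by rewrite !(updC _ _ _ da) IH.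
Qed.

Lemma grid_sumD D F F' x :
  grid_sum D (fun y => F y + F' y) x = grid_sum D F x + grid_sum D F' x.
Proof.
elim: D x => //= d D IH x; under eq_bigr do rewrite IH; exact: big_split.
Qed.

Lemma grid_sum_big D (I : seq nat) (F : nat -> (nat -> nat) -> 'F_2) x :
  grid_sum D (fun y => \sum_(i <- I) F i y) x = \sum_(i <- I) grid_sum D (F i) x.
Proof.
elim: D x => //= d D IH x; under eq_bigr do rewrite IH; exact: exchange_big.
Qed.

Lemma grid_sum_telescope (D : seq nat) F x d : d \in D -> uniq D ->
  grid_sum D (fun y => F (step d y) + F y) x =
  grid_sum (without d D) F (upd x d N) + grid_sum (without d D) F (upd x d 0).
Proof.
move=> dD uD; rewrite (grid_sum_without _ _ dD) //=.
have dD' : d \notin without d D by rewrite mem_filter eqxx.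
under eq_bigr do rewrite grid_sumD (grid_sum_step F) //.
elim: N => [|n IH]; first by rewrite big_geq // addFF2.
rewrite big_nat_recr //= IH addrC addrA; congr (_ + _).
by rewrite -addrA addFF2 addr0.
Qed.

Lemma eq_grid_sum D F F' x :
  (forall y, (forall e, e \notin D -> y e = x e) -> F y = F' y) ->
  grid_sum D F x = grid_sum D F' x.
Proof.
elim: D x => [|d D IH] x /= eF; first exact: eF.
apply: eq_bigr => i _; apply: IH => y ey; apply: eF => e.
by rewrite inE negb_or => /andP[ed eD]; rewrite ey // /upd (negbTE ed).
Qed.

Lemma grid_sum_neq0 D F x : grid_sum D F x != 0 ->
  exists y, [/\ forall d, d \in D -> (y d < N)%N,
                forall d, d \notin D -> y d = x d & F y != 0].
Proof.
elim: D x => [|d D IH] x /=; first by move=> Fx; exists x.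
rewrite big_nat => sn0.
have [i iN gi] : exists2 i, (i < N)%N & grid_sum D F (upd x d i) != 0.
  have [//|H] := pselect (exists2 i, (i < N)%N & grid_sum D F (upd x d i) != 0).
  move: sn0; rewrite big1 ?eqxx // => i /andP[_ iN].
  by apply/eqP; apply: contra_notT H => gi; exists i.
have [y [yD ynD Fy]] := IH _ gi; exists y; split => //.
  move=> e; rewrite inE; have [->|/=] := eqVneq e d; last by move=> _; exact: yD.
  have [/yD//|/ynD ->] := boolP (d \in D).
  by rewrite /upd eqxx.
move=> e; rewrite inE negb_or => /andP[ed /ynD ->].
by rewrite /upd (negbTE ed).
Qed.

Hypothesis N_gt0 : (0 < N)%N.

(** Summing the Stokes formula over the grid leaves only the boundary faces of
the grid. A face orthogonal to a direction other than [l] contributes 0 since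
the coboundary of its own label vanishes there; the face [y l = 0] contributes 0
since [s l] does; on the face [y l = N] the label is 1, and what remains is the
same sum in one dimension less. *)
Lemma grid_cup_total L x : uniq L ->
  (forall l, l \in L -> forall y c, y l = c -> c = 0%N \/ c = N -> s l y = (c == N)%:R) ->
  grid_sum L (fun y => cube_cup s L y L) x = 1.
Proof.
elim: L x => // l L IH x uL sL.
have [lL uL'] := andP uL.
have wl : without l (l :: L) = L by rewrite /without /= eqxx /=; exact: without_notin.
have -> : grid_sum (l :: L) (fun y => cube_cup s (l :: L) y (l :: L)) x =
    \sum_(d <- l :: L)
    (grid_sum (without d (l :: L)) (fun y => s l y * cube_cup s L y (without d (l :: L))) (upd x d N)
   + grid_sum (without d (l :: L)) (fun y => s l y * cube_cup s L y (without d (l :: L))) (upd x d 0)).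
  rewrite big_seq.
  under [RHS]eq_bigr => d dL.
    rewrite -(@grid_sum_telescope _ (fun y => s l y * cube_cup s L y (without d (l :: L)))) //; over.
  rewrite -big_seq -grid_sum_big.
  by apply: eq_grid_sum => y _; rewrite cube_cup_stokes.
rewrite big_cons wl.
rewrite [X in X + _](_ : _ = 1); last first.
  rewrite -[RHS]addr0; congr (_ + _).
    rewrite -[RHS](IH (upd x l N)) //; last by move=> d dL; apply: sL; rewrite inE dL orbT.
    apply: eq_grid_sum => y yl.
    rewrite (sL l _ y N) ?mem_head ?eqxx ?mul1r //; last by right.
    by rewrite yl // /upd eqxx.
  rewrite (@eq_grid_sum _ _ (fun y => 0)); first by elim: (L) (upd x l 0) => //= a L' IH' z; rewrite big1.
  move=> y yl; rewrite (sL l _ y 0%N) ?mem_head ?mul0r //; last by left.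
    by rewrite eq_sym -leqn0 leqNgt N_gt0 mul0r.
  by rewrite yl // /upd eqxx.
rewrite big_seq big1 ?addr0 // => d dL.
have vanish c : c = 0%N \/ c = N ->
    grid_sum (without d (l :: L)) (fun y => s l y * cube_cup s L y (without d (l :: L))) (upd x d c) = 0.
  move=> hc; rewrite (@eq_grid_sum _ _ (fun y => 0)).
    by elim: (without _ _) (upd x d c) => //= a L' IH' z; rewrite big1.
  move=> y yd.
  have yd' : y d = c by rewrite yd ?mem_filter ?eqxx // /upd eqxx.
  rewrite (@cube_cup_face L y _ d N) ?mulr0 ?mem_filter ?eqxx // ?yd' //.
  by apply: sL; rewrite inE dL orbT.
by rewrite !vanish ?addr0; auto.
Qed.

End sums.

Lemma cube_cup_neq0 L x D : uniq D -> cube_cup s L x D != 0 ->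
  forall l, l \in L -> exists y y', [/\ s l y != s l y',
    forall i, (x i <= y i <= x i + (i \in D))%N &
    forall i, (x i <= y' i <= x i + (i \in D))%N].
Proof.
elim: L x D => //= a L IH x D uD; rewrite big_seq => sn0.
have [d dD /[!mulf_eq0] /norP[ds dc]] : exists2 d, d \in D &
   (s a (step d x) + s a x) * cube_cup s L (step d x) (without d D) != 0.
  have [//|H] := pselect (exists2 d, d \in D &
   (s a (step d x) + s a x) * cube_cup s L (step d x) (without d D) != 0).
  move: sn0; rewrite big1 ?eqxx // => d dD.
  by apply/eqP; apply: contra_notT H => gi; exists d.
have bound y : (forall i, step d x i <= y i <= step d x i + (i \in without d D))%N ->
    forall i, (x i <= y i <= x i + (i \in D))%N.
  move=> hy i; have := hy i; rewrite /step mem_filter.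
  have [->|ne] := eqVneq i d; rewrite /= ?dD ?addn0 //.
  by move=> /andP[h1 h2]; rewrite h2 (leq_trans _ h1) ?leq_addr.
move=> l; rewrite inE; have [-> _|la /= lL] := eqVneq l a.
  exists (step d x), x; split.
  - by apply: contraNneq ds => ->; rewrite addFF2.
  - move=> i; rewrite /step leq_addr leq_add2l /=.
    by have [->|] := eqVneq i d; rewrite ?dD.
  - by move=> i; rewrite leqnn leq_addr.
have [y [y' [h1 h2 h3]]] := IH _ _ (filter_uniq _ uD) dc l lL.
by exists y, y'; split => //; exact: bound.
Qed.

End grid_cochains.

(** The total being odd, some cube has a nonzero product, and in that cube every
label takes both values. *)
Theorem discrete_poincare_miranda (m N : nat) (s : nat -> (nat -> nat) -> bool) :
  (0 < N)%N ->
  (forall l x, (l < m)%N -> x l = 0%N -> s l x = false) ->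
  (forall l x, (l < m)%N -> x l = N -> s l x = true) ->
  exists x : nat -> nat, forall l, (l < m)%N -> (x l < N)%N /\
    exists y y', [/\ s l y, ~~ s l y',
      forall i, (i < m)%N -> (x i <= y i <= (x i).+1)%N &
      forall i, (i < m)%N -> (x i <= y' i <= (x i).+1)%N].
Proof.
move=> N0 s0 sN.
pose t l x : 'F_2 := (s l x)%:R.
have tb l : l \in iota 0 m -> forall y c, y l = c -> c = 0%N \/ c = N -> t l y = (c == N)%:R.
  rewrite mem_iota add0n => /andP[_ lm] y c <- [yl|yl]; rewrite /t.
    by rewrite s0 // yl eq_sym -leqn0 leqNgt N0.
  by rewrite sN // yl eqxx.
have := grid_cup_total N0 (fun=> 0%N) (iota_uniq 0 m) tb.
move=> /eqP; rewrite -subr_eq0 => /eqP g1.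
have /grid_sum_neq0[x [xN _ cx]] : grid_sum N (iota 0 m)
    (fun y => cube_cup t (iota 0 m) y (iota 0 m)) (fun=> 0%N) != 0.
  by move/eqP: g1; rewrite subr_eq0 => /eqP ->; exact: oner_neq0.
exists x => l lm; split; first by apply: xN; rewrite mem_iota.
have lI : l \in iota 0 m by rewrite mem_iota.
have [y [y' [h1 h2 h3]]] := cube_cup_neq0 (iota_uniq 0 m) cx lI.
have h i z : (i < m)%N -> (forall i, x i <= z i <= x i + (i \in iota 0 m))%N -> (x i <= z i <= (x i).+1)%N.
  by move=> im /(_ i); rewrite mem_iota /= add0n im addn1.
have [sy|sy] := boolP (s l y).
  exists y, y'; split; [by []| |by move=> i im; apply: h|by move=> i im; apply: h].
  by apply: contraNN h1; rewrite /t sy => ->.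
exists y', y; split; [|by []|by move=> i im; apply: h|by move=> i im; apply: h].
by apply: contraNT h1; rewrite /t (negbTE sy) => /negbTE ->.
Qed.

(** * Brouwer's theorem on cubes *)

Section Brouwer.
Variable R : realType.

Definition unit_cube m : set 'rV[R]_m := [set x | forall i, 0 <= x ord0 i <= 1].

Lemma compact_unit_cube m : compact (@unit_cube m).
Proof.
have := @rV_compact R m (fun=> `[0, 1]%classic) (fun=> @segment_compact R 0 1).
by congr compact; apply/seteqP; split=> x /= H i; have := H i; rewrite in_itv.
Qed.

(** The truncation at the top of the grid keeps every lattice point inside the
cube, where [G] is known to be a self-map. *)
Definition grid_point m (n : nat) (z : nat -> nat) : 'rV[R]_m :=
  \row_i ((minn (z i) n.+1)%:R / n.+1%:R).

Lemma grid_point_cube m n z : unit_cube (grid_point m n z).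
Proof.
move=> i; rewrite mxE divr_ge0 //= ler_pdivrMr ?ltr0n // mul1r ler_nat.
exact: geq_minr.
Qed.

Lemma grid_point_close m n (y z : nat -> nat) (i : 'I_m) :
  (z i < n.+1)%N -> (z i <= y i <= (z i).+1)%N ->
  `|grid_point m n z ord0 i - grid_point m n y ord0 i| <= n.+1%:R^-1.
Proof.
move=> zn /andP[zy yz].
rewrite !mxE -mulrBl normrM normfV normr_nat ler_pdivrMr ?ltr0n // mulVf ?pnatr_eq0 //.
rewrite (minn_idPl (ltnW zn)) (minn_idPl (leq_trans yz zn)) distrC -natrB //.
by rewrite normr_nat lern1 leq_subLR addn1.
Qed.

(** Label [l] tells whether coordinate [l] of [G] lies below that of the point.
A cube on which every label takes both values is a cell in which every
coordinate of G - id changes sign. *)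
Lemma cube_near_fixpoint m (G : 'rV[R]_m -> 'rV[R]_m) (n : nat) :
  (forall x, unit_cube x -> unit_cube (G x)) ->
  exists a : 'rV[R]_m, unit_cube a /\ forall i, exists p q : 'rV[R]_m,
    [/\ G p ord0 i <= p ord0 i, q ord0 i <= G q ord0 i,
        unit_cube p /\ unit_cube q,
        forall j, `|a ord0 j - p ord0 j| <= n.+1%:R^-1 &
        forall j, `|a ord0 j - q ord0 j| <= n.+1%:R^-1].
Proof.
case: m G => [|m] G Gcube.
  by exists 0; split=> [|] [].
pose pt := grid_point m.+1 n.
pose s l z := (0 < z l)%N && (G (pt z) ord0 (inord l) <= pt z ord0 (inord l)).
have [//|l z _ zl|l z lm zl|x xP] := @discrete_poincare_miranda m.+1 n.+1 s.
- by rewrite /s zl.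
- rewrite /s zl /= mxE inordK // zl minnn divff ?pnatr_eq0 //.
  by have /andP[] := Gcube _ (@grid_point_cube m.+1 n z) (inord l).
exists (pt x); split; first exact: grid_point_cube.
move=> i; have [_ [y [y' [sy sy' hy hy']]]] := xP i (ltn_ord i).
exists (pt y), (pt y'); split.
- by move: sy => /andP[_]; rewrite inord_val.
- move: sy'; rewrite negb_and lt0n negbK inord_val -ltNge => /orP[/eqP y0|/ltW //].
  rewrite mxE y0 min0n mul0r.
  by have /andP[] := Gcube _ (@grid_point_cube m.+1 n y') i.
- by split; exact: grid_point_cube.
- by move=> j; apply: grid_point_close; [case: (xP j (ltn_ord j))|apply: hy].
- by move=> j; apply: grid_point_close; [case: (xP j (ltn_ord j))|apply: hy'].
Qed.

(** Brouwer's theorem: the cells of [cube_near_fixpoint] shrink to a point as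
the mesh goes to 0, and at a cluster point every coordinate of G - id has to be
both nonnegative and nonpositive. *)
Theorem brouwer_cube m (G : 'rV[R]_m -> 'rV[R]_m) :
  (forall x, unit_cube x -> {for x, continuous G}) ->
  (forall x, unit_cube x -> unit_cube (G x)) ->
  exists2 x, unit_cube x & G x = x.
Proof.
move=> Gcont Gcube.
have [a aP] := choice (fun n => @cube_near_fixpoint m G n Gcube).
have [] := @compact_unit_cube m (a @ \oo).
  by exists 0%N => // n _; case: (aP n).
move=> x [xcube xcl]; exists x => //.
apply/rowP => i; apply/eqP; rewrite -subr_eq0 -normr_le0.
apply/ler_addgt0Pl => e e0; rewrite addr0.
have Hcont : {for x, continuous (fun y => G y ord0 i - y ord0 i)}.
  apply: continuousB; last exact: coord_continuous.
  by apply: (@continuous_comp _ _ _ G (fun M : 'rV[R]_m => M ord0 i));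
    [exact: Gcont|exact: coord_continuous].
have /cvgrPdist_lt/(_ _ e0)/nbhs_ballP[d /= d0 dP] := Hcont.
have d20 : 0 < d / 2 by rewrite divr_gt0.
have big : (a @ \oo) [set b | exists n, b = a n /\ n.+1%:R^-1 < d / 2].
  have := near_infty_natSinv_lt (PosNum d20); apply: filterS => n /= nd.
  by exists n.
have [_ [[n [-> nd]] [_ xb]]] := xcl _ _ big (nbhsx_ballx x _ d20).
have [_ /(_ i)[p [q [Gp Gq _ pa qa]]]] := aP n.
have near_x (b : 'rV[R]_m) : (forall j, `|a n ord0 j - b ord0 j| <= n.+1%:R^-1) -> ball x d b.
  move=> ab; split => // i' j; rewrite (ord1 i').
  rewrite [d]splitr; apply: ball_triangle (xb _ j) _.
  by rewrite -ball_normE /=; exact: le_lt_trans (ab j) nd.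
have := dP _ (near_x _ pa); have := dP _ (near_x _ qa).
rewrite /= !ltr_distl => /andP[h1 h2] /andP[h3 h4].
rewrite ler_norml; apply/andP; split; lra.
Qed.

End Brouwer.

(** * Totally bounded sets *)

Section totally_bounded.
Context {R : realType} {X : normedModType R}.

Definition totally_bounded (A : set X) := forall e : R, 0 < e ->
  exists c : seq X, forall x, A x -> exists2 y, y \in c & `|x - y| < e.

(** Centers can be moved into the set, at the price of doubling the radius. *)
Lemma totally_bounded_centers (A : set X) : totally_bounded A ->
  forall e : R, 0 < e -> exists c : seq X,
    (forall y, y \in c -> A y) /\
    forall x, A x -> exists2 y, y \in c & `|x - y| < e.
Proof.
move=> tbA e e0.
have [c cP] := tbA _ (divr_gt0 e0 (ltr0Sn R 1)).
suff [c' [c'A c'P]] : exists c' : seq X, (forall y, y \in c' -> A y) /\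
    forall x, A x -> (exists2 y, y \in c & `|x - y| < e / 2) ->
      exists2 y, y \in c' & `|x - y| < e.
  by exists c'; split=> // x Ax; apply: c'P => //; exact: cP.
elim: c {cP} => [|z c [c' [c'A c'P]]]; first by exists [::]; split=> // x _ [].
have [[a [Aa az]]|noz] := pselect (exists a, A a /\ `|a - z| < e / 2).
  exists (a :: c'); split=> [y|x Ax [y]]; first by rewrite inE => /predU1P[-> //|/c'A].
  rewrite inE => /predU1P[-> xz|yc xy].
    exists a; rewrite ?mem_head // (splitr e) (le_lt_trans (ler_distD z _ _)) //.
    by rewrite ltrD // distrC.
  have [|y' y'c xy'] := c'P x Ax; first by exists y.
  by exists y' => //; rewrite inE y'c orbT.
exists c'; split=> // x Ax [y]; rewrite inE => /predU1P[-> xz|yc xy].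
  by case: noz; exists x.
by apply: c'P => //; exists y.
Qed.

End totally_bounded.

(** * Approximate fixed points in normed spaces *)

Lemma continuous_row {R : realType} (T : topologicalType) m (g : T -> 'rV[R]_m) x :
  (forall i, {for x, continuous (fun t => g t ord0 i)}) -> {for x, continuous g}.
Proof.
move=> gc A /nbhs_ballP[e e0 eA].
have : \forall t \near x, forall i, ball (g x ord0 i) e (g t ord0 i).
  by apply: filter_forall => i; exact: (gc i _ (nbhsx_ballx _ _ e0)).
apply: filterS => t gt; apply: eA; split=> // i j.
by rewrite (ord1 i).
Qed.

Lemma continuous_sum {R : realType} {V : normedModType R} (T : topologicalType)
    m (F : 'I_m -> T -> V) x :
  (forall i, {for x, continuous (F i)}) -> {for x, continuous (fun t => \sum_i F i t)}.
Proof. by move=> Fc; apply: (cvg_big add_continuous) => i _; exact: Fc. Qed.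

Section Schauder.
Context {R : realType} {X : normedModType R}.
Variables (c : seq X) (e : R).

Let y (i : 'I_(size c)) := c`_i.

(** Weights of the Schauder projection onto the points of [c]. *)
Definition tent i (x : X) : R := Num.max 0 (e - `|x - y i|).

Definition tent_sum x := \sum_i tent i x.

(** A combination of the points of [c] that is defined for all coefficients in
the cube, stays in any ball centered at 0 containing [c], and is the convex
combination when the coefficients add up to 1: this allows Brouwer's theorem to
be used on a cube rather than on a simplex. *)
Definition damped_comb (l : 'rV[R]_(size c)) : X :=
  (Num.max 1 (\sum_i l ord0 i))^-1 *: \sum_i l ord0 i *: y i.

Lemma tent_ge0 i x : 0 <= tent i x.
Proof. by rewrite le_max lexx. Qed.

Lemma tent_continuous i : continuous (tent i).
Proof.
move=> x; apply: (@continuous_max _ _ (cst 0) (fun x => e - `|x - y i|)).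
  exact: cst_continuous.
apply: continuousB; first exact: cst_continuous.
apply: (@continuous_comp _ _ _ (fun z => z - y i) Num.norm); last exact: norm_continuous.
by apply: continuousB; [exact: cvg_id|exact: cst_continuous].
Qed.

Lemma tent_sum_continuous : continuous tent_sum.
Proof.
by move=> x; apply: continuous_sum => i; exact: tent_continuous.
Qed.

Lemma tent_sum_gt0 x : (exists2 z, z \in c & `|x - z| < e) -> 0 < tent_sum x.
Proof.
move=> [z zc xz]; have ic : (index z c < size c)%N by rewrite index_mem.
rewrite /tent_sum (bigD1 (Ordinal ic)) //= ltr_wpDr //; last first.
  by rewrite lt_max /y /= nth_index // subr_gt0 xz orbT.
by apply: sumr_ge0 => i _; exact: tent_ge0.
Qed.

Lemma damped_comb_continuous : continuous damped_comb.
Proof.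
move=> l.
apply: (@continuousZ _ _ _ (fun l : 'rV[R]_(size c) => (Num.max 1 (\sum_i l ord0 i))^-1)
  (fun l : 'rV[R]_(size c) => \sum_i l ord0 i *: y i)).
  apply: continuousV; first by rewrite gt_eqF // lt_max ltr01.
  apply: (@continuous_max _ _ (cst 1) (fun l : 'rV[R]_(size c) => \sum_i l ord0 i)).
    exact: cst_continuous.
  by apply: (@continuous_sum _ _ _ _ (fun i (l : 'rV[R]_(size c)) => l ord0 i)) => i; exact: coord_continuous.
apply: (@continuous_sum _ _ _ _ (fun i (l : 'rV[R]_(size c)) => l ord0 i *: y i)) => i.
apply: (@continuousZ _ _ _ (fun l : 'rV[R]_(size c) => l ord0 i) (fun=> y i)).
  exact: coord_continuous.
exact: cst_continuous.
Qed.

Lemma damped_comb_norm M l : (forall z, z \in c -> `|z| <= M) -> 0 <= M -> unit_cube l ->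
  `|damped_comb l| <= M.
Proof.
move=> cM M0 lc; have m0 : 0 < Num.max 1 (\sum_i l ord0 i) by rewrite lt_max ltr01.
rewrite normrZ normfV (gtr0_norm m0) mulrC ler_pdivrMr //.
apply: (le_trans (ler_norm_sum _ _ _)).
apply: (@le_trans _ _ (\sum_i l ord0 i * M)).
  apply: ler_sum => i _; have /andP[li _] := lc i.
  by rewrite normrZ (ger0_norm li) ler_wpM2l // cM // mem_nth.
by rewrite -mulr_suml mulrC ler_wpM2l // le_max lexx orbT.
Qed.

End Schauder.

(** Schauder's theorem in approximate form. The map sending coefficients [l] to
the normalized weights of Phi(a(l)) is a self-map of the cube; its fixed point
has coefficients of sum 1, so a(l) is the Schauder projection of Phi(a(l)),
which is at distance at most [e] from Phi(a(l)). *)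
Theorem schauder_approx {R : realType} {X : normedModType R} (Phi : X -> X) (M : R) :
  continuous Phi -> 0 <= M ->
  (forall x, `|x| <= M -> `|Phi x| <= M) ->
  totally_bounded (Phi @` [set x | `|x| <= M]) ->
  forall e : R, 0 < e -> exists a, `|a| <= M /\ `|Phi a - a| <= e.
Proof.
move=> Phic M0 PhiM tb e e0.
have [c [cA cP]] := totally_bounded_centers tb e0.
have cM z : z \in c -> `|z| <= M by move=> /cA[x xM <-]; exact: PhiM.
pose a := @damped_comb R X c.
have aM l : unit_cube l -> `|a l| <= M by exact: damped_comb_norm.
pose S l := tent_sum c e (Phi (a l)).
have S0 l : unit_cube l -> 0 < S l.
  by move=> lc; apply: tent_sum_gt0; apply: cP; exists (a l) => //; exact: aM.
have compc (h : X -> R) : continuous h -> continuous (fun l => h (Phi (a l))).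
  move=> hc l; apply: (@continuous_comp _ _ _ (fun l => Phi (a l)) h); last exact: hc.
  apply: (@continuous_comp _ _ _ a Phi); last exact: Phic.
  exact: damped_comb_continuous.
pose G l : 'rV[R]_(size c) := \row_i (tent e i (Phi (a l)) / S l).
have [l lc lG] : exists2 l, unit_cube l & G l = l.
  apply: brouwer_cube => [l lc|l lc i].
    apply: continuous_row => i.
    have -> : (fun t => G t ord0 i) = (fun t => tent e i (Phi (a t)) * (S t)^-1).
      by apply/funext => t; rewrite mxE.
    apply: continuousM; first exact/compc/tent_continuous.
    apply: continuousV; first by rewrite gt_eqF // S0.
    exact/compc/tent_sum_continuous.
  rewrite mxE divr_ge0 ?tent_ge0 ?(ltW (S0 l lc)) //= ler_pdivrMr ?S0 // mul1r.
  rewrite /S /tent_sum (bigD1 i) //= lerDl.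
  by apply: sumr_ge0 => j _; exact: tent_ge0.
exists (a l); split; first exact: aM.
have lE i : l ord0 i = tent e i (Phi (a l)) / S l by rewrite -[in LHS]lG mxE.
have sum1 : \sum_i l ord0 i = 1.
  by under eq_bigr do rewrite lE; rewrite -mulr_suml divff // gt_eqF // S0.
have {2}-> : a l = \sum_i l ord0 i *: c`_i.
  by rewrite /a /damped_comb sum1 maxxx invr1 scale1r.
have -> : Phi (a l) = \sum_i l ord0 i *: Phi (a l) by rewrite -scaler_suml sum1 scale1r.
rewrite -sumrB; apply: (le_trans (ler_norm_sum _ _ _)).
apply: (@le_trans _ _ (\sum_i l ord0 i * e)); last by rewrite -mulr_suml sum1 mul1r.
apply: ler_sum => i _; have /andP[li _] := lc i.
rewrite -scalerBr normrZ (ger0_norm li) lE mulrAC [leRHS]mulrAC.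
rewrite ler_wpM2r ?invr_ge0 ?(ltW (S0 _ lc)) //.
have [far|near] := lerP e `|Phi (a l) - c`_i|.
  by rewrite /tent (max_idPl _) ?mul0r // subr_le0.
by rewrite ler_wpM2l ?tent_ge0 // ltW.
Qed.

(** * Sums of elements of totally bounded sets *)

Lemma ultra_has {I : Type} {J : eqType} (U : set_system I) (c : seq J) (P : J -> set I) :
  UltraFilter U -> U [set i | exists2 y, y \in c & P y i] ->
  exists2 y, y \in c & U (P y).
Proof.
move=> UU; elim: c => [|z c IH].
  by move=> /filter_ex[i [y]].
move=> H; have [Uz|Uz] := in_ultra_setVsetC (P z) UU.
  by exists z; rewrite ?mem_head.
have [|y yc Uy] := IH; last by exists y; rewrite // inE yc orbT.
apply: filterS2 H Uz => i [y]; rewrite inE => /predU1P[->|yc] Pi Pz //.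
by exists y.
Qed.

Section totally_bounded_more.
Context {R : realType} {X : normedModType R}.
Implicit Types A B C : set X.

Lemma totally_bounded_subset A B : A `<=` B -> totally_bounded B -> totally_bounded A.
Proof.
by move=> AB tb e e0; have [c cP] := tb e e0; exists c => x /AB; exact: cP.
Qed.

Lemma compact_totally_bounded A : compact A -> totally_bounded A.
Proof.
rewrite compact_cover => cA e e0.
have [|x Ax|D _ AD] := cA X setT (fun x => ball x e).
- by move=> x _; exact: ball_open.
- by exists x => //; exact: ballxx.
exists (finmap.enum_fset D) => x /AD[y yD]; rewrite -ball_normE /= distrC => xy.
by exists y.
Qed.

Lemma precompact_totally_bounded A : precompact A -> totally_bounded A.
Proof.
rewrite precompactE => /compact_totally_bounded; apply: totally_bounded_subset.
exact: subset_closure.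
Qed.

Lemma totally_bounded_lipschitz A (g : X -> X) (k : R) : 0 < k ->
  (forall x y, `|g x - g y| <= k * `|x - y|) ->
  totally_bounded A -> totally_bounded (g @` A).
Proof.
move=> k0 gk tb e e0; have [c cP] := tb _ (divr_gt0 e0 k0).
exists (map g c) => _ [x /cP[y yc xy] <-]; exists (g y); first exact: map_f.
by rewrite (le_lt_trans (gk _ _)) // mulrC -ltr_pdivlMr.
Qed.

Fixpoint combs (t : R) (c : seq X) : set X :=
  if c is z :: c' then
    [set x | exists a s, [/\ 0 <= a <= t, combs t c' s & x = a *: z + s]]
  else [set 0].

Lemma combs_le t t' c : t <= t' -> combs t c `<=` combs t' c.
Proof.
move=> tt'; elim: c => //= z c IH _ [a [s [/andP[a0 at_] /IH sc ->]]].
by exists a, s; rewrite a0 (le_trans at_).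
Qed.

Lemma combs0 t c : 0 <= t -> combs t c 0.
Proof.
move=> t0; elim: c => //= z c IH; exists 0, 0; split => //; first by rewrite lexx.
by rewrite scale0r addr0.
Qed.

Lemma combs_add t h c s z : 0 <= h -> z \in c -> combs t c s ->
  combs (t + h) c (h *: z + s).
Proof.
move=> h0; elim: c s => //= y c IH s.
rewrite inE => /predU1P[-> [a [r [/andP[a0 at_] rc ->]]]|zc [a [r [/andP[a0 at_] rc ->]]]].
  exists (h + a), r; split; first by rewrite addr_ge0 //= addrC lerD2r.
    by apply: combs_le rc; rewrite lerDl.
  by rewrite scalerDl addrA.
exists a, (h *: z + r); split; last by rewrite addrCA.
  by rewrite a0 (le_trans at_) // lerDl.
exact: IH.
Qed.

Lemma totally_bounded_combs t c : totally_bounded (combs t c).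
Proof.
elim: c => [|z c IH] e e0 /=.
  by exists [:: 0] => x ->; exists 0; rewrite ?mem_head // subrr normr0.
have e2 : 0 < e / 2 by rewrite divr_gt0.
have [cs csP] := IH _ e2.
have z0 : 0 < `|z| + 1 by rewrite ltr_wpDl.
have [ca caP] : exists ca : seq R, forall a, 0 <= a <= t ->
    exists2 b, b \in ca & `|a - b| < e / 2 / (`|z| + 1).
  have := @segment_compact R 0 t; rewrite compact_cover.
  move=> /(_ R setT (fun b => ball b (e / 2 / (`|z| + 1)))) [|a _|D _ AD].
  - by move=> b _; exact: ball_open.
  - by exists a => //; apply: ballxx; rewrite divr_gt0.
  exists (finmap.enum_fset D) => a at_; have [b bD] := AD a at_.
  by rewrite -ball_normE /= distrC; exists b.
exists [seq b *: z + y | b <- ca, y <- cs] => _ [a [s [/caP[b bc ab] /csP[y yc sy] ->]]].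
exists (b *: z + y); first exact: allpairs_f.
rewrite opprD addrACA -scalerBl (splitr e) (le_lt_trans (ler_normD _ _)) // ltrD //.
rewrite normrZ; apply: (@le_lt_trans _ _ (`|a - b| * (`|z| + 1))).
  by rewrite ler_wpM2l // lerDl.
by rewrite -ltr_pdivlMr.
Qed.

Definition riemann_sums (t : R) C : set X :=
  [set x | exists (n : nat) (h : R) (g : nat -> X),
    [/\ 0 <= h, h * n%:R <= t, forall j, (j < n)%N -> C (g j) &
        x = \sum_(0 <= j < n) h *: g j]].

(** Replacing every term by a center of a finite net of [C] moves the sum by at
most [t] times the radius of the net and turns it into a combination of the
finitely many centers with coefficients in [0, t]. *)
Lemma totally_bounded_riemann_sums t C :
  totally_bounded C -> totally_bounded (riemann_sums t C).
Proof.
move=> tb e e0.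
have e2 : 0 < e / 2 by rewrite divr_gt0.
have d0 : 0 < e / 2 / (`|t| + 1) by rewrite divr_gt0 // ltr_wpDl.
have [c cP] := tb _ d0.
have [c' c'P] := @totally_bounded_combs t c _ e2.
exists c' => _ [n [h [g [h0 hn gC ->]]]].
suff [s sc sg] : exists2 s, combs (h * n%:R) c s &
    `|\sum_(0 <= j < n) h *: g j - s| <= h * n%:R * (e / 2 / (`|t| + 1)).
  have [y yc sy] := c'P _ (combs_le hn sc).
  exists y => //; rewrite (splitr e) (le_lt_trans (ler_distD s _ _)) // ltrD //.
  apply: (le_lt_trans sg); rewrite mulrCA gtr_pMr // ltr_pdivrMr ?ltr_wpDl // mul1r.
  by rewrite (le_lt_trans hn) // (le_lt_trans (ler_norm t)) // ltrDl.
elim: n gC {hn} => [|n IH] gC.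
  exists 0; first by apply: combs0; rewrite mulr0.
  by rewrite big_nil subr0 normr0 mulr0 mul0r.
have [j jn|s sc sg] := IH; first by apply: gC; rewrite ltnS ltnW.
have [y yc gy] := cP _ (gC n (ltnSn n)).
exists (h *: y + s); first by rewrite -[n.+1]addn1 natrD mulrDr mulr1; exact: combs_add.
rewrite big_nat_recr //= [h *: y + s]addrC opprD addrACA -scalerBr.
rewrite (le_trans (ler_normD _ _)) // -[n.+1]addn1 natrD mulrDr mulr1 mulrDl lerD //.
by rewrite normrZ (ger0_norm h0) ler_wpM2l // ltW.
Qed.

End totally_bounded_more.

(** One of the finitely many balls of every net belongs to the image
ultrafilter, which is therefore a Cauchy filter. *)
Lemma totally_bounded_ultra_cvg {R : realType} {X : completeNormedModType R}
    (U : set_system nat) (A : set X) (x : nat -> X) :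
  UltraFilter U -> totally_bounded A -> (forall n, A (x n)) -> cvg (x @ U).
Proof.
move=> UU tb xA; apply: cauchy_cvg; apply: cauchy_exP => e e0.
have [c cP] := tb _ e0.
have [|y yc Uy] := @ultra_has _ _ U c (fun y n => `|x n - y| < e) UU.
  by apply: filterS filterT => n _; apply: cP.
exists y; rewrite -ball_normE; apply: (@filterS _ U _ _ _ _ Uy) => n xny /=.
by rewrite distrC.
Qed.

(** * Limits of Euler polygons *)

(** Within [0, T], [y] has derivative [p] at [t]; the quotient-free form is what
passes to the limit and to the components of a pair. *)
Definition has_slope {R : realType} {Z : normedModType R} (T : R) (y : R -> Z)
    (t : R) (p : Z) : Prop :=
  forall e, 0 < e -> exists2 d, 0 < d & forall s, 0 <= s <= T -> `|s - t| < d ->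
    `|y s - y t - (s - t) *: p| <= e * `|s - t|.

Section euler.
Context {R : realType} {Z : normedModType R}.

(** With [p := 0] this is the Lipschitz estimate for the polygon, with [p] the
value of the field it compares the polygon with a straight line. *)
Lemma euler_increment (N : nat) (h : R) (z g : nat -> Z) (p : Z) (e : R) a b :
  0 <= h -> (forall j, (j < N)%N -> z j.+1 = z j + h *: g j) ->
  (a <= N)%N -> (b <= N)%N ->
  (forall j, (minn a b <= j < maxn a b)%N -> `|g j - p| <= e) ->
  `|z b - z a - (h * (b%:R - a%:R)) *: p| <= e * (h * `|b%:R - a%:R|).
Proof.
move=> h0 zS; wlog ab : a b / (a <= b)%N => [wl aN bN gp|aN bN].
  have [ab|/ltnW ba] := leqP a b; first exact: wl.
  have := wl b a ba bN aN; rewrite minnC maxnC => /(_ gp).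
  rewrite (distrC a%:R) -(opprB b%:R) mulrN scaleNr opprK -normrN.
  by rewrite opprD opprB.
rewrite (minn_idPl ab) (maxn_idPr ab).
elim: b ab bN => [|b IH] ab bN gp.
  move: ab gp; rewrite leqn0 => /eqP -> _.
  by rewrite !subrr mulr0 scale0r subr0 !normr0 !mulr0.
move: ab; rewrite leq_eqVlt => /predU1P[<-|]; first by rewrite !subrr mulr0 scale0r subr0 !normr0 !mulr0.
rewrite ltnS => ab.
have ab' : 0 <= b%:R - a%:R :> R by rewrite subr_ge0 ler_nat.
have {}IH := IH ab (ltnW bN).
have -> : b.+1%:R - a%:R = 1 + (b%:R - a%:R) :> R by rewrite -addn1 natrD; ring.
rewrite (ger0_norm ab') in IH; rewrite (ger0_norm (addr_ge0 ler01 ab')).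
have -> : z b.+1 - z a - (h * (1 + (b%:R - a%:R))) *: p =
   h *: (g b - p) + (z b - z a - (h * (b%:R - a%:R)) *: p).
  rewrite zS // mulrDr mulr1 scalerDl scalerBr opprD !addrA; congr (_ + _).
  rewrite [z b + _]addrC -!addrA; congr (_ + _).
  by rewrite [- (_ *: _) + _]addrC -!addrA.
rewrite (le_trans (ler_normD _ _)) // [h * (1 + _)]mulrDr mulr1 mulrDr lerD //; last first.
  by apply: IH => j /andP[aj jb]; apply: gp; rewrite aj ltnW.
by rewrite normrZ ger0_norm // mulrC ler_wpM2r // gp // ab ltnSn.
Qed.

Variables (T : R) (Psi : R * Z -> Z) (z : nat -> nat -> Z) (L : R).
Hypothesis T_gt0 : 0 < T.

Definition mesh (n : nat) : R := T / n.+1%:R.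

Definition node (n : nat) (t : R) : nat := Num.trunc (t / mesh n).

Lemma mesh_gt0 n : 0 < mesh n.
Proof. by rewrite divr_gt0. Qed.

Lemma node_itv n t : 0 <= t -> mesh n * (node n t)%:R <= t < mesh n * (node n t)%:R + mesh n.
Proof.
move=> t0; have := truncn_itv (divr_ge0 t0 (ltW (mesh_gt0 n))).
rewrite ler_pdivlMr ?mesh_gt0 // ltr_pdivrMr ?mesh_gt0 // -natr1 mulrDl mul1r.
by rewrite mulrC.
Qed.

Lemma node_le n t : 0 <= t <= T -> (node n t <= n.+1)%N.
Proof.
move=> /andP[t0 tT]; rewrite -(ler_nat R) -(ler_pM2l (mesh_gt0 n)).
have /andP[h _] := node_itv n t0; rewrite (le_trans h) // (le_trans tT) //.
by rewrite /mesh divfK.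
Qed.

Lemma mesh_cvg0 (U : set_system nat) : ProperFilter U -> \oo `<=` U ->
  mesh n @[n --> U] --> 0.
Proof.
move=> UU Uoo; have : mesh n @[n --> \oo] --> 0.
  rewrite -(mulr0 T); apply: cvgM; first exact: cvg_cst.
  exact: cvg_harmonic.
by move=> H A /H; exact: Uoo.
Qed.

Lemma node_diff n s t : 0 <= s -> 0 <= t ->
  `|mesh n * ((node n s)%:R - (node n t)%:R) - (s - t)| <= mesh n.
Proof.
move=> s0 t0; have /andP[s1 s2] := node_itv n s0; have /andP[t1 t2] := node_itv n t0.
by rewrite mulrBr ler_norml; apply/andP; split; lra.
Qed.

Lemma node_between n s t j : 0 <= s -> 0 <= t ->
  (minn (node n t) (node n s) <= j < maxn (node n t) (node n s))%N ->
  `|mesh n * j%:R - t| <= `|s - t| + mesh n /\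
  mesh n * `|j%:R - (node n t)%:R| <= `|s - t| + mesh n.
Proof.
move=> s0 t0; have /andP[s1 s2] := node_itv n s0; have /andP[t1 t2] := node_itv n t0.
have m0 := mesh_gt0 n.
have st : s - t <= `|s - t| by exact: ler_norm.
have ts : t - s <= `|s - t| by rewrite distrC; exact: ler_norm.
have ler_mesh a b : (a <= b)%N -> mesh n * a%:R <= mesh n * b%:R.
  by move=> ab; rewrite ler_pM2l // ler_nat.
have -> : mesh n * `|j%:R - (node n t)%:R| = `|mesh n * j%:R - mesh n * (node n t)%:R|.
  by rewrite -mulrBr normrM (gtr0_norm m0).
rewrite !ler_norml; have [tn|tn] := leqP (node n t) (node n s).
  move=> /andP[/ler_mesh h1 /ltnW/ler_mesh h2].
  by split; apply/andP; split; lra.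
move=> /andP[/ler_mesh h1 /ltnW/ler_mesh h2].
by split; apply/andP; split; lra.
Qed.

Hypothesis zS : forall n j, (j < n.+1)%N ->
  z n j.+1 = z n j + mesh n *: Psi (mesh n * j%:R, z n j).
Hypothesis zL : forall n j, (j < n.+1)%N -> `|Psi (mesh n * j%:R, z n j)| <= L.

(** A pointwise limit of Euler polygons with bounded slopes solves the equation.
Near time [t] the polygons stay close to [y t], by the bound on the slopes and
by convergence at the single time [t]; there the field is within [e] of its
value [p] at (t, y t), so increments of the polygons over [t, s] are within
e |s - t| of (s - t) p up to an error of the order of the mesh. *)
Theorem euler_limit (U : set_system nat) (y : R -> Z) t :
  ProperFilter U -> \oo `<=` U ->
  (forall t, 0 <= t <= T -> z n (node n t) @[n --> U] --> y t) ->
  0 <= t <= T -> {for (t, y t), continuous Psi} ->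
  has_slope T y t (Psi (t, y t)).
Proof.
move=> UU Uoo zy t0T Psic e e0.
have L0 : 0 <= L by apply: le_trans (zL (ltnSn 0)).
have L10 : 0 < L + 1 by rewrite ltr_wpDl.
have /andP[t0 tT] := t0T.
have /cvgrPdist_le/(_ _ e0)/nbhs_ballP[r /= r0 rP] := Psic.
pose p := Psi (t, y t).
(* On a time interval of this length, a polygon moves by less than r / 2. *)
exists (r / 2 / (L + 1)); first by rewrite !divr_gt0.
move=> s s0T st; have /andP[s0 sT] := s0T.
rewrite ltr_pdivlMr // in st.
have mesh0 := mesh_cvg0 UU Uoo.
have estimate : \forall n \near U,
    `|z n (node n s) - z n (node n t) - (s - t) *: p| - mesh n * (e + `|p|) <= e * `|s - t|.
  have r40 : 0 < r / 4 by rewrite divr_gt0.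
  have near_zt : \forall n \near U, `|y t - z n (node n t)| < r / 4.
    exact: (@cvgrPdist_lt _ _ _ U _ _ _).1 (zy t t0T) _ r40.
  have near_mesh : \forall n \near U, mesh n * (L + 1) < r / 4.
    have d0 : 0 < r / 4 / (L + 1) by rewrite divr_gt0.
    have mesh_small : \forall n \near U, `|0 - mesh n| < r / 4 / (L + 1).
      exact: (@cvgrPdist_lt _ _ _ U _ _ _).1 mesh0 _ d0.
    apply: filterS mesh_small => n; rewrite sub0r normrN (gtr0_norm (mesh_gt0 n)).
    by rewrite ltr_pdivlMr.
  apply: filterS2 near_zt near_mesh => n zt hm.
  have m0 := mesh_gt0 n.
  set b := node n s; set a := node n t.
  have bN : (b <= n.+1)%N by exact: node_le.
  have aN : (a <= n.+1)%N by exact: node_le.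
  have close j : (minn a b <= j < maxn a b)%N -> `|Psi (mesh n * j%:R, z n j) - p| <= e.
    move=> jab; have [j1 j2] := node_between s0 t0 jab.
    have jN : (j < n.+1)%N.
      by have /andP[_ h] := jab; apply: leq_trans h _; rewrite geq_max aN bN.
    rewrite distrC; apply: rP; split=> /=.
      rewrite -ball_normE /= distrC (le_lt_trans j1) //.
      have h1 : `|s - t| <= `|s - t| * (L + 1) by rewrite ler_peMr // lerDr.
      have h2 : mesh n <= mesh n * (L + 1) by rewrite ler_peMr ?lerDr // ltW.
      lra.
    have := @euler_increment n.+1 (mesh n) (z n) (fun j => Psi (mesh n * j%:R, z n j))
      0 L a j (ltW m0) (zS (n := n)) aN (ltnW jN).
    rewrite scaler0 subr0 => /(_ _)/le_lt_trans inc.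
    rewrite -ball_normE /= (le_lt_trans (ler_distD (z n a) _ _)) //.
    rewrite [r](_ : _ = r / 4 + (r - r / 4)); last by lra.
    rewrite ltrD // distrC inc //.
      move=> i iaj; rewrite subr0; apply: zL; have /andP[_ h] := iaj.
      by apply: leq_trans h _; rewrite geq_max aN ltnW.
    have h1 : L * (mesh n * `|j%:R - a%:R|) <= L * (`|s - t| + mesh n) by rewrite ler_wpM2l.
    have h2 : 0 <= `|s - t| by [].
    lra.
  have := @euler_increment n.+1 (mesh n) (z n) (fun j => Psi (mesh n * j%:R, z n j))
      p e a b (ltW m0) (zS (n := n)) aN bN close.
  have nd := node_diff n s0 t0.
  have -> : z n b - z n a - (s - t) *: p =
     (z n b - z n a - (mesh n * (b%:R - a%:R)) *: p) +
     (mesh n * (b%:R - a%:R) - (s - t)) *: p.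
    by rewrite [X in _ = _ + X]scalerBl addrA subrK.
  move=> inc; rewrite lerBlDr (le_trans (ler_normD _ _)) //.
  have h1 : `|(mesh n * (b%:R - a%:R) - (s - t)) *: p| <= mesh n * `|p|.
    by rewrite normrZ ler_wpM2r.
  have h2 : mesh n * `|b%:R - a%:R| <= `|s - t| + mesh n.
    rewrite -[X in X * _ <= _](gtr0_norm m0) -normrM -[X in `|X|](subrK (s - t)).
    by rewrite (le_trans (ler_normD _ _)) // addrC lerD2l.
  have h3 : e * (mesh n * `|b%:R - a%:R|) <= e * (`|s - t| + mesh n).
    by rewrite ler_wpM2l // ltW.
  lra.
have lim_est : `|z n (node n s) - z n (node n t) - (s - t) *: p| - mesh n * (e + `|p|)
    @[n --> U] --> `|y s - y t - (s - t) *: p|.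
  have -> : `|y s - y t - (s - t) *: p| =
      `|y s - y t - (s - t) *: p| - 0 * (e + `|p|) by rewrite mul0r subr0.
  apply: cvgB; last by apply: cvgM; [exact: mesh0|exact: cvg_cst].
  apply: cvg_norm; apply: cvgB; last exact: cvg_cst.
  by apply: cvgB; exact: zy.
rewrite -(cvg_lim _ lim_est) //; apply: limr_le => //.
by apply/cvg_ex; eexists; exact: lim_est.
Qed.

End euler.

(** * Derivatives within a segment *)

Section derive_in_segment.
Context {R : realType} {X : normedModType R}.
Variable T : R.
Hypothesis T_gt0 : 0 < T.

(** No point of the segment is isolated in it, so limits of difference quotients
are unique. *)
Lemma within_segment_proper t : 0 <= t <= T ->
  ProperFilter (within `[0, T]%classic t^').
Proof.
move=> /andP[t0 tT]; apply: Build_ProperFilter_ex => P.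
move=> /nbhs_ballP[r /= r0 rP].
have [s [s0 sT st sr]] : exists s, [/\ 0 <= s, s <= T, s != t & `|t - s| < r].
  have [tT'|Tt] := ltP t T.
    have m0 : 0 < Num.min (r / 2) (T - t) by rewrite lt_min divr_gt0 // subr_gt0.
    have m1 : Num.min (r / 2) (T - t) <= r / 2 by rewrite ge_min lexx.
    have m2 : Num.min (r / 2) (T - t) <= T - t by rewrite ge_min lexx orbT.
    exists (t + Num.min (r / 2) (T - t)); split; [lra|lra|by rewrite gt_eqF ?ltrDl|].
    by rewrite distrC addrC addKr gtr0_norm //; lra.
  have m0 : 0 < Num.min (r / 2) T by rewrite lt_min divr_gt0.
  have m1 : Num.min (r / 2) T <= r / 2 by rewrite ge_min lexx.
  have m2 : Num.min (r / 2) T <= T by rewrite ge_min lexx orbT.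
  exists (t - Num.min (r / 2) T); split; [lra|lra|by rewrite lt_eqF // gtrDl oppr_lt0|].
  by rewrite opprB addrC subrK gtr0_norm //; lra.
by exists s; apply: (rP s) => //=; rewrite in_itv /= s0 sT.
Qed.

Lemma derive_in_segment (u : R -> X) (p : X) t : 0 <= t <= T ->
  has_slope T u t p ->
  derivable_in `[0, T]%classic u t /\ derive_in `[0, T]%classic u t = p.
Proof.
move=> t0T H; have PF := within_segment_proper t0T.
suff ucvg : (s - t)^-1 *: (u s - u t) @[s --> within `[0, T]%classic t^'] --> p.
  by split; [apply/cvg_ex; exists p|exact: cvg_lim].
apply/cvgrPdist_le => e e0; have [d d0 dP] := H e e0.
apply/nbhs_ballP; exists d => //= s; rewrite -ball_normE /= distrC => st s_neq_t.
rewrite in_itv /= => s0T.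
have st0 : s - t != 0 by rewrite subr_eq0.
have -> : p - (s - t)^-1 *: (u s - u t) = - ((s - t)^-1 *: (u s - u t - (s - t) *: p)).
  by rewrite [in RHS]scalerBr scalerA mulVf // scale1r opprB.
by rewrite normrN normrZ normfV mulrC ler_pdivrMr ?normr_gt0 // dP.
Qed.

Lemma C1_on_segment (u v : R -> X) :
  (forall t, 0 <= t <= T -> has_slope T u t (v t)) ->
  {within `[0, T]%classic, continuous v} ->
  C1_on `[0, T]%classic u /\ {in `[0, T]%classic, derive_in `[0, T]%classic u =1 v}.
Proof.
move=> H vc.
have D t : t \in `[0, T]%classic ->
    derivable_in `[0, T]%classic u t /\ derive_in `[0, T]%classic u t = v t.
  by rewrite inE /= in_itv /= => t0T; apply: derive_in_segment => //; exact: H.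
split=> [|t /D[]//]; split=> [t /D[]//|].
by apply: (subspace_eq_continuous _ vc) => t tA; exact: (esym (D t tA).2).
Qed.

End derive_in_segment.

Lemma has_slope_within_continuous {R : realType} {X : normedModType R} (T : R)
    (y v : R -> X) :
  (forall t, 0 <= t <= T -> has_slope T y t (v t)) ->
  forall t, 0 <= t <= T -> y s @[s --> within `[0, T]%classic (nbhs t)] --> y t.
Proof.
move=> H t t0T; apply/cvgrPdist_lt => e e0.
have [d d0 dP] := H t t0T 1 ltr01.
have b0 : 0 < 1 + `|v t| by rewrite ltr_wpDr.
apply/nbhs_ballP; exists (Num.min d (e / (1 + `|v t|))) => /=.
  by rewrite lt_min d0 divr_gt0.
move=> s; rewrite -ball_normE /= distrC lt_min => /andP[sd se]; rewrite in_itv /= => s0T.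
rewrite distrC -[y s - y t](subrK ((s - t) *: v t)) (le_lt_trans (ler_normD _ _)) //.
apply: (@le_lt_trans _ _ (`|s - t| * (1 + `|v t|))).
  by rewrite normrZ mulrDr mulr1 lerD2r -[leRHS]mul1r dP.
by rewrite -ltr_pdivlMr.
Qed.

(** * Shooting for the discretized problem *)

Lemma continuous_pair {S U V : topologicalType} (f : S -> U) (g : S -> V) x :
  {for x, continuous f} -> {for x, continuous g} ->
  {for x, continuous (fun t => (f t, g t))}.
Proof. by move=> fc gc; exact: (cvg_pair fc gc). Qed.

Section shooting.
Context {R : realType} {X : completeNormedModType R}.
Variables (T : R) (psi : X -> X) (F : R * X * X -> X) (k c0 c1 : R).
Hypothesis T_gt0 : 0 < T.
Hypothesis psi0 : psi 0 = 0.
Hypothesis k_gt0 : 0 < k.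
Hypothesis psi_lip : forall x y, `|psi x - psi y| <= k * `|x - y|.
Hypothesis psi_cont : continuous psi.
Hypothesis F_cont : continuous F.
Hypothesis c0_ge0 : 0 <= c0.
Hypothesis c1_ge0 : 0 <= c1.
Hypothesis F_growth : forall t x y, `|F (t, x, y)| <= c0 + c1 * `|y|.
Hypothesis F_compact : forall M : R, totally_bounded
  [set z | exists t x y, [/\ `|x| <= M, `|y| <= M & z = F (t, x, y)]].

(** The equation as a first-order system for the pair of [u] and w = phi(u'),
where [psi] is the inverse of phi: u' = psi w and w' = F(t, u, psi w). *)
Definition euler_field (p : R * (X * X)) : X * X :=
  (psi p.2.2, F (p.1, p.2.1, psi p.2.2)).

(** The condition u'(0) = 0 becomes w = 0 at time 0, so only the initial value
[a] of [u] is free. *)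
Fixpoint euler (n : nat) (a : X) (j : nat) : X * X :=
  if j is j'.+1 then
    euler n a j' + mesh T n *: euler_field (mesh T n * j'%:R, euler n a j')
  else (a, 0).

(** Bounds on w and on u' that depend neither on the mesh nor on [a]. *)
Let wbound := T * c0 * expR (c1 * k * T).
Let vbound := k * wbound.

Lemma psi_norm x : `|psi x| <= k * `|x|.
Proof. by have := psi_lip x 0; rewrite psi0 !subr0. Qed.

Lemma mesh_steps n j : (j <= n.+1)%N -> mesh T n * j%:R <= T.
Proof.
move=> jn; rewrite /mesh mulrAC -mulrA ger_pMr // ler_pdivrMr // mul1r.
by rewrite ler_nat.
Qed.

Lemma wbound_ge0 : 0 <= wbound.
Proof. by rewrite !mulr_ge0 ?expR_ge0 // ltW. Qed.

Lemma vbound_ge0 : 0 <= vbound.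
Proof. by rewrite mulr_ge0 ?wbound_ge0 // ltW. Qed.

(** Discrete Gronwall inequality: w satisfies |w'| <= c0 + c1 k |w|, w(0) = 0. *)
Lemma euler_w_bound n a j : (j <= n.+1)%N -> `|(euler n a j).2| <= wbound.
Proof.
move=> jn; have h0 : 0 < mesh T n by exact: mesh_gt0.
have c0' : 0 <= c1 * k by rewrite mulr_ge0 // ltW.
(* The bound t c0 exp(c1 k t) at t = mesh * j is reproduced by one Euler step
   because 1 + x <= exp x. *)
apply: (@le_trans _ _ (mesh T n * j%:R * c0 * expR (c1 * k * (mesh T n * j%:R)))); last first.
  have hT := mesh_steps jn.
  apply: ler_pM; [by rewrite !mulr_ge0 // ltW|exact: expR_ge0|by rewrite ler_wpM2r|].
  by rewrite ler_expR ler_wpM2l.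
elim: j jn => [|j IH] jn; first by rewrite /= normr0 mulr0 !mul0r.
have {}IH := IH (ltnW jn).
set h := mesh T n in h0 IH *.
set E := expR (c1 * k * (h * j%:R)) in IH *.
have -> : c1 * k * (h * j.+1%:R) = c1 * k * (h * j%:R) + c1 * k * h.
  by rewrite -addn1 natrD; ring.
rewrite expRD -/E.
have E1 : 1 <= E by rewrite -expR0 ler_expR !mulr_ge0 // ltW.
have D1 : 1 + c1 * k * h <= expR (c1 * k * h) by exact: expR_ge1Dx.
set D := expR _ in D1 *.
have D11 : 1 <= D by apply: le_trans D1; rewrite lerDl mulr_ge0 // ltW.
have ED1 : 1 <= E * D by rewrite -[leLHS]mulr1 ler_pM.
rewrite [euler _ _ _]/= /=.
set w := (euler n a j).2 in IH *; set u := (euler n a j).1.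
apply: (le_trans (ler_normD _ _)); rewrite normrZ (gtr0_norm h0).
have Fw : `|F (h * j%:R, u, psi w)| <= c0 + c1 * (k * `|w|).
  by apply: (le_trans (F_growth _ _ _)); rewrite lerD2l ler_wpM2l // psi_norm.
have hFw : h * `|F (h * j%:R, u, psi w)| <= h * (c0 + c1 * (k * `|w|)).
  by rewrite ler_wpM2l // ltW.
apply: (@le_trans _ _ (`|w| * (1 + c1 * k * h) + h * c0)).
  by rewrite mulrDr mulr1; move: hFw; rewrite mulrDr; lra.
have -> : h * j.+1%:R * c0 * (E * D) = h * j%:R * c0 * E * D + h * c0 * (E * D).
  by rewrite -addn1 natrD; ring.
rewrite lerD //; last by rewrite ler_peMr // mulr_ge0 // ltW.
by apply: ler_pM => //; rewrite addr_ge0 // mulr_ge0 // ltW.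
Qed.

Lemma euler_v_bound n a j : (j <= n.+1)%N -> `|psi (euler n a j).2| <= vbound.
Proof.
move=> jn; apply: (le_trans (psi_norm _)).
by rewrite ler_wpM2l ?(ltW k_gt0) // euler_w_bound.
Qed.

Lemma euler_u_sum n a j :
  (euler n a j).1 = a + \sum_(0 <= i < j) mesh T n *: psi (euler n a i).2.
Proof.
elim: j => [|j IH]; first by rewrite big_nil addr0.
by rewrite big_nat_recr //= addrA -IH.
Qed.

Lemma euler_w_sum n a j : (euler n a j).2 = \sum_(0 <= i < j) mesh T n *:
  F (mesh T n * i%:R, (euler n a i).1, psi (euler n a i).2).
Proof.
elim: j => [|j IH]; first by rewrite big_nil.
by rewrite big_nat_recr //= -IH.
Qed.

Lemma euler_u_bound n a j : (j <= n.+1)%N -> `|(euler n a j).1 - a| <= T * vbound.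
Proof.
move=> jn; rewrite euler_u_sum addrC addKr.
apply: (le_trans (ler_norm_sum _ _ _)).
apply: (@le_trans _ _ (\sum_(0 <= i < j) mesh T n * vbound)).
  rewrite big_nat [leRHS]big_nat; apply: ler_sum => i /andP[_ ij].
  rewrite normrZ (gtr0_norm (mesh_gt0 T_gt0 n)) ler_wpM2l ?(ltW (mesh_gt0 _ _)) //.
  by apply: euler_v_bound; exact: leq_trans (ltnW ij) jn.
rewrite big_const_nat subn0 iter_addr_0 -mulr_natr mulrAC.
by rewrite ler_wpM2r ?vbound_ge0 // mesh_steps.
Qed.

Lemma euler_field_cont : continuous euler_field.
Proof.
have c1' : continuous (fun p : R * (X * X) => p.2.1).
  by move=> p; apply: (@continuous_comp _ _ _ (@snd R (X * X)) fst); [exact: cvg_snd|exact: cvg_fst].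
have c2' : continuous (fun p : R * (X * X) => psi p.2.2).
  move=> p; apply: (@continuous_comp _ _ _ (fun p : R * (X * X) => p.2.2) psi); last exact: psi_cont.
  by apply: (@continuous_comp _ _ _ (@snd R (X * X)) snd); [exact: cvg_snd|exact: cvg_snd].
move=> p; apply: (@continuous_pair _ _ _ (fun p : R * (X * X) => psi p.2.2)); first exact: c2'.
apply: (@continuous_comp _ _ _ (fun p : R * (X * X) => (p.1, p.2.1, psi p.2.2)) F); last exact: F_cont.
apply: (@continuous_pair _ _ _ (fun p : R * (X * X) => (p.1, p.2.1))); last exact: c2'.
by apply: (@continuous_pair _ _ _ (@fst R (X * X))); [exact: cvg_fst|exact: c1'].
Qed.

Lemma euler_cont n j : continuous (fun a => euler n a j).
Proof.
elim: j => [|j IH] a /=.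
  by apply: continuous_pair; [exact: cvg_id|exact: cvg_cst].
apply: (@continuousD _ _ _ (fun a => euler n a j)); first exact: IH.
apply: (@continuousZ _ _ _ (fun=> mesh T n)); first exact: cst_continuous.
apply: (@continuous_comp _ _ _ (fun a => (mesh T n * j%:R, euler n a j)) euler_field).
  by apply: continuous_pair; [exact: cvg_cst|exact: IH].
exact: euler_field_cont.
Qed.

(** Radius of a ball containing all u and u' of polygons whose initial value is
in the ball of radius [T * vbound]. *)
Let M := 2 * (T * vbound) + vbound.

(** As Riemann sums of values of [F] on a bounded set, resp. of [psi] on the set
just obtained, w and u - a stay in totally bounded sets that depend neither on
the mesh nor on [a]. *)
Let Wset := riemann_sums T [set z | exists t x y, [/\ `|x| <= M, `|y| <= M & z = F (t, x, y)]].
Let Uset := riemann_sums T (psi @` Wset).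

Lemma Wset_totally_bounded : totally_bounded Wset.
Proof. by apply: totally_bounded_riemann_sums; exact: F_compact. Qed.

Lemma Uset_totally_bounded : totally_bounded Uset.
Proof.
apply: totally_bounded_riemann_sums.
exact: (totally_bounded_lipschitz k_gt0 psi_lip Wset_totally_bounded).
Qed.

Lemma euler_w_in n a j : (j <= n.+1)%N -> `|a| <= T * vbound -> Wset (euler n a j).2.
Proof.
move=> jn aM; exists j, (mesh T n), (fun i => F (mesh T n * i%:R, (euler n a i).1, psi (euler n a i).2)).
split.
- by rewrite ltW // mesh_gt0.
- exact: mesh_steps.
- move=> i ij; have iN : (i <= n.+1)%N by exact: leq_trans (ltnW ij) jn.
  exists (mesh T n * i%:R), (euler n a i).1, (psi (euler n a i).2); split=> //.
    rewrite -[(euler n a i).1](subrK a) (le_trans (ler_normD _ _)) //.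
    have := euler_u_bound a iN; have := vbound_ge0; rewrite /M; lra.
  apply: (le_trans (euler_v_bound a iN)).
  by rewrite /M lerDr !mulr_ge0 ?vbound_ge0 // ltW.
- exact: euler_w_sum.
Qed.

Lemma euler_u_in n a j : (j <= n.+1)%N -> `|a| <= T * vbound -> Uset ((euler n a j).1 - a).
Proof.
move=> jn aM; exists j, (mesh T n), (fun i => psi (euler n a i).2); split.
- by rewrite ltW // mesh_gt0.
- exact: mesh_steps.
- move=> i ij; exists (euler n a i).2 => //; apply: euler_w_in => //.
  exact: leq_trans (ltnW ij) jn.
- by rewrite euler_u_sum addrC addKr.
Qed.

(** A fixed point of this map is an initial value for which u ends at 0. *)
Definition shoot n a := a - (euler n a n.+1).1.

Lemma opp_Uset_totally_bounded : totally_bounded (-%R @` Uset).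
Proof.
apply: (@totally_bounded_lipschitz _ _ _ _ 1) Uset_totally_bounded => // x y.
by rewrite mul1r -opprD normrN.
Qed.

Lemma shoot_in n a : `|a| <= T * vbound -> (-%R @` Uset) (shoot n a).
Proof.
move=> aM; exists ((euler n a n.+1).1 - a); first exact: euler_u_in.
by rewrite opprB.
Qed.

Lemma approx_shot n : exists a : X, `|a| <= T * vbound /\ `|(euler n a n.+1).1| <= n.+1%:R^-1.
Proof.
have shoot_cont : continuous (shoot n).
  move=> a; apply: (@continuousB _ _ _ id (fun a => (euler n a n.+1).1)).
    exact: cvg_id.
  apply: (@continuous_comp _ _ _ (fun a => euler n a n.+1) fst); first exact: euler_cont.
  exact: cvg_fst.
have shoot_ball a : `|a| <= T * vbound -> `|shoot n a| <= T * vbound.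
  by move=> _; rewrite distrC; exact: euler_u_bound.
have shoot_tb : totally_bounded (shoot n @` [set a | `|a| <= T * vbound]).
  apply: totally_bounded_subset opp_Uset_totally_bounded => _ [a /= aM <-].
  exact: shoot_in.
have M0 : 0 <= T * vbound by rewrite mulr_ge0 ?vbound_ge0 // ltW.
have e0 : 0 < n.+1%:R^-1 :> R by rewrite invr_gt0.
have [a [aM ha]] := schauder_approx shoot_cont M0 shoot_ball shoot_tb e0.
exists a; split=> //; move: ha.
by rewrite /shoot addrAC subrr add0r normrN.
Qed.


Lemma euler_field_bound n a j : (j < n.+1)%N ->
  `|euler_field (mesh T n * j%:R, euler n a j)| <= vbound + (c0 + c1 * vbound).
Proof.
move=> jn; have v0 := vbound_ge0; have vj := euler_v_bound a (ltnW jn).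
have c1v : 0 <= c1 * vbound by rewrite mulr_ge0.
rewrite prod_normE ge_max /=; apply/andP; split.
  by rewrite (le_trans vj) // lerDl addr_ge0.
apply: (le_trans (F_growth _ _ _)); rewrite (@le_trans _ _ (c0 + c1 * vbound)) ?lerDr //.
by rewrite lerD2l ler_wpM2l.
Qed.

Lemma node0 n : node T n 0 = 0%N.
Proof. by rewrite /node mul0r truncn0. Qed.

Lemma nodeT n : node T n T = n.+1.
Proof. by rewrite /node /mesh invf_div mulrCA divff ?gt_eqF // mulr1 natrK. Qed.

(** For every mesh there is a polygon ending within one over the number of steps
of 0. Its values at each time lie, up to that error, in totally bounded sets, so
along a nonprincipal ultrafilter the polygons converge at all times at once, and
[euler_limit] identifies the limit. *)
Theorem shooting_solution : exists y : R -> X * X,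
  [/\ (y T).1 = 0, (y 0).2 = 0 &
    forall t, 0 <= t <= T -> has_slope T y t (euler_field (t, y t))].
Proof.
have [a aP] := choice approx_shot.
have [U [UU Uoo]] := ultraFilterLemma (eventually_filter).
have UP : ProperFilter U by exact: ultra_proper.
have endpoint0 : (euler n (a n) n.+1).1 @[n --> U] --> (0 : X).
  have h : (euler n (a n) n.+1).1 @[n --> \oo] --> (0 : X).
    apply/cvgr0Pnorm_le => e e0; have := near_infty_natSinv_lt (PosNum e0).
    apply: filterS => n /= ne; apply: le_trans (ltW ne); exact: (aP n).2.
  by move=> A /h; exact: Uoo.
have w_cvg t : 0 <= t <= T -> cvg ((euler n (a n) (node T n t)).2 @[n --> U]).
  move=> t0T; apply: (totally_bounded_ultra_cvg UU Wset_totally_bounded) => n.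
  by apply: euler_w_in; [exact: node_le|exact: (aP n).1].
have shoot_cvg : cvg (shoot n (a n) @[n --> U]).
  apply: (totally_bounded_ultra_cvg UU opp_Uset_totally_bounded) => n.
  by apply: shoot_in; exact: (aP n).1.
have u_cvg t : 0 <= t <= T -> cvg ((euler n (a n) (node T n t)).1 @[n --> U]).
  move=> t0T; have d_cvg : cvg (((euler n (a n) (node T n t)).1 - a n) @[n --> U]).
    apply: (totally_bounded_ultra_cvg UU Uset_totally_bounded) => n.
    by apply: euler_u_in; [exact: node_le|exact: (aP n).1].
  (* The initial values a n converge because a n = shoot n (a n) + u(T), where
     the first term stays in a totally bounded set and the second tends to 0. *)
  have -> : (fun n => (euler n (a n) (node T n t)).1) = (fun n =>
      (euler n (a n) (node T n t)).1 - a n + (shoot n (a n) + (euler n (a n) n.+1).1)).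
    by apply/funext => n; rewrite /shoot !subrK.
  apply: is_cvgD; first exact: d_cvg.
  by apply: is_cvgD; [exact: shoot_cvg|apply/cvg_ex; exists 0].
pose y t := (lim ((euler n (a n) (node T n t)).1 @[n --> U]),
             lim ((euler n (a n) (node T n t)).2 @[n --> U])).
have y_cvg t : 0 <= t <= T -> euler n (a n) (node T n t) @[n --> U] --> y t.
  move=> t0T; have -> : (fun n => euler n (a n) (node T n t)) = (fun n =>
      ((euler n (a n) (node T n t)).1, (euler n (a n) (node T n t)).2)).
    by apply/funext => n; exact: surjective_pairing.
  exact: (cvg_pair (u_cvg t t0T) (w_cvg t t0T)).
exists y; split.
- rewrite /y /=; under eq_fun do rewrite nodeT.
  exact: cvg_lim endpoint0.
- rewrite /y /=; under eq_fun do rewrite node0.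
  by rewrite /= lim_cst.
- move=> t t0T.
  apply: (@euler_limit _ _ T euler_field (fun n => euler n (a n))
    (vbound + (c0 + c1 * vbound)) T_gt0 _ _ U y t UP Uoo y_cvg t0T) => //.
    by move=> n j; exact: euler_field_bound.
  exact: euler_field_cont.
Qed.

End shooting.

(** * The boundary value problem *)

Section clamp.
Context {R : realType} {X : normedModType R}.
Variable T : R.
Hypothesis T_gt0 : 0 < T.

Definition clamp (t : R) : R := Num.max 0 (Num.min t T).

Lemma clamp_itv t : 0 <= clamp t <= T.
Proof.
by rewrite /clamp le_max lexx ge_max (ltW T_gt0) ge_min lexx orbT.
Qed.

Lemma clamp_id t : 0 <= t <= T -> clamp t = t.
Proof. by move=> /andP[t0 tT]; rewrite /clamp (min_idPl tT) (max_idPr t0). Qed.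

Lemma clamp_continuous : continuous clamp.
Proof.
move=> t; apply: (@continuous_max _ _ (cst 0) (fun t => Num.min t T)).
  exact: cst_continuous.
apply: (@continuous_min _ _ id (cst T)); first exact: cvg_id.
exact: cst_continuous.
Qed.

(** Clamping time to [0, T] extends [f] to a map that is continuous on the whole
space and takes no new values. *)
Lemma clamp_extension_continuous (f : R * X * X -> X) :
  {within (`[0, T]%classic `*` setT `*` setT), continuous f} ->
  continuous (fun p => f (clamp p.1.1, p.1.2, p.2)).
Proof.
move=> /subspace_continuousP fc p.
pose c (q : R * X * X) := (clamp q.1.1, q.1.2, q.2).
have cD q : (`[0, T]%classic `*` setT `*` setT) (c q).
  by split=> //; split=> //=; rewrite in_itv /= clamp_itv.
have cc : {for p, continuous c}.
  have c1 : {for p, continuous (fun q : R * X * X => (clamp q.1.1, q.1.2))}.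
    apply: (@continuous_pair _ _ _ (fun q : R * X * X => clamp q.1.1) (fun q : R * X * X => q.1.2)).
      apply: (@continuous_comp _ _ _ (fun q : R * X * X => q.1.1) clamp); last exact: clamp_continuous.
      by apply: (@continuous_comp _ _ _ (@fst (R * X) X) fst); exact: cvg_fst.
    by apply: (@continuous_comp _ _ _ (@fst (R * X) X) snd); [exact: cvg_fst|exact: cvg_snd].
  by apply: (@continuous_pair _ _ _ (fun q : R * X * X => (clamp q.1.1, q.1.2))); [exact: c1|exact: cvg_snd].
have cw : c q @[q --> p] --> within (`[0, T]%classic `*` setT `*` setT) (nbhs (c p)).
  move=> A wA; apply: (@filterS _ (nbhs p) _ _ _ _ (cc _ wA)) => q Aq.
  exact: Aq (cD q).
exact: (cvg_comp _ _ cw (fc _ (cD p))).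
Qed.

End clamp.

Theorem theorem4p1 (R : realType) (X : completeNormedModType R) (T : R)
    (hT : 0 < T)
    (phi phiinv : X -> X)
    (hphi : homeomorphism_with_inverse phi phiinv)
    (hphi0 : phi 0 = 0)
    (k : R) (hk : 0 < k) (hlip : k.-lipschitz phiinv)
    (f : R * X * X -> X)
    (hf : completely_continuous_on (`[0, T]%classic `*` setT `*` setT) f)
    (c0 c1 : R) (hc0 : 0 <= c0) (hc1 : 0 <= c1)
    (hgrowth : forall (t : R) (x y : X), t \in `[0, T] ->
      `|f (t, x, y)| <= c0 + c1 * `|y|) :
  exists u : R -> X, bvp_solution T phi f u.
Proof.
have [phiK phiinvK phi_cont phiinv_cont] := hphi.
have phiinv0 : phiinv 0 = 0 by rewrite -hphi0 phiK.
have phiinv_lip x y : `|phiinv x - phiinv y| <= k * `|x - y|.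
  exact: (hlip (x, y)).
have [f_cont f_compact] := hf.
pose F (p : R * X * X) := f (clamp T p.1.1, p.1.2, p.2).
have F_cont : continuous F by exact: clamp_extension_continuous.
have FE t x y : 0 <= t <= T -> F (t, x, y) = f (t, x, y).
  by move=> t0T; rewrite /F /= clamp_id.
have F_growth t x y : `|F (t, x, y)| <= c0 + c1 * `|y|.
  by apply: hgrowth; rewrite in_itv /= clamp_itv.
have F_compact (M : R) : totally_bounded
    [set z | exists t x y, [/\ `|x| <= M, `|y| <= M & z = F (t, x, y)]].
  pose B : set (R * X * X) :=
    [set p | [/\ 0 <= p.1.1 <= T, `|p.1.2| <= M & `|p.2| <= M]].
  apply: (@totally_bounded_subset _ _ _ (f @` B)).
    move=> _ [t [x [y [xM yM ->]]]]; exists (clamp T t, x, y) => //.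
    by split=> //; exact: clamp_itv.
  apply/precompact_totally_bounded/f_compact.
    by move=> p [p1 _ _]; split=> //; split=> //=; rewrite in_itv.
  exists (Num.max T M); split=> [|M' MM' p [/andP[p0 pT] pM pM']]; first exact: num_real.
  apply: le_trans (ltW MM').
  by rewrite !prod_normE !ge_max !le_max (ger0_norm p0) pT pM pM' !orbT.
have [y [yT y0 dy]] := shooting_solution hT phiinv0 hk phiinv_lip phiinv_cont
  F_cont hc0 hc1 F_growth F_compact.
pose v t := phiinv (y t).2.
have du t : 0 <= t <= T -> has_slope T (fst \o y) t (v t).
  move=> t0T e e0; have [d d0 dP] := dy t t0T e e0; exists d => // s s0T st.
  by apply: le_trans (dP s s0T st); rewrite prod_normE le_max lexx.
have dw t : 0 <= t <= T -> has_slope T (snd \o y) t (F (t, (y t).1, v t)).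
  move=> t0T e e0; have [d d0 dP] := dy t t0T e e0; exists d => // s s0T st.
  by apply: le_trans (dP s s0T st); rewrite [leRHS]prod_normE le_max lexx orbT.
have field_within : {within `[0, T]%classic, continuous (fun t => euler_field phiinv F (t, y t))}.
  apply/subspace_continuousP => t /=; rewrite in_itv /= => t0T.
  have yc := has_slope_within_continuous dy t0T.
  have tc : s @[s --> within `[0, T]%classic (nbhs t)] --> t by exact: cvg_within.
  apply: (@cvg_comp _ _ _ (fun s => (s, y s)) (euler_field phiinv F) _ (nbhs (t, y t))).
    exact: (cvg_pair tc yc).
  have fc : {for (t, y t), continuous (euler_field phiinv F)} by exact: euler_field_cont.
  exact fc.
have v_within : {within `[0, T]%classic, continuous v}.
  by move=> t; apply: (@continuous_comp (subspace `[0, T]%classic) _ _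
    (fun t => euler_field phiinv F (t, y t)) fst); [exact: field_within|exact: cvg_fst].
have Fv_within : {within `[0, T]%classic, continuous (fun t => F (t, (y t).1, v t))}.
  by move=> t; apply: (@continuous_comp (subspace `[0, T]%classic) _ _
    (fun t => euler_field phiinv F (t, y t)) snd); [exact: field_within|exact: cvg_snd].
have [C1u u'E] := C1_on_segment hT du v_within.
have phi_u' t : 0 <= t <= T -> phi (derive_in `[0, T]%classic (fst \o y) t) = (y t).2.
  by move=> t0T; rewrite u'E ?inE /= ?in_itv //= phiinvK.
have [C1w w'E] : C1_on `[0, T]%classic (phi \o derive_in `[0, T]%classic (fst \o y)) /\
    {in `[0, T]%classic, derive_in `[0, T]%classic (phi \o derive_in `[0, T]%classic (fst \o y))
       =1 (fun t => F (t, (y t).1, v t))}.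
  apply: C1_on_segment => // t t0T e e0; have [d d0 dP] := dw t t0T e e0.
  by exists d => // s s0T st; rewrite /= !phi_u' // dP.
have mem0 : 0 \in `[0, T]%classic by rewrite inE /= in_itv /= lexx ltW.
exists (fst \o y); split=> //.
- by split=> //; rewrite u'E // /v y0.
- move=> t tI; have t0T : 0 <= t <= T by move: tI; rewrite inE /= in_itv.
  by rewrite w'E // u'E // FE.
Qed.
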